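(* Let $(M_n)$ be a non-analytic weight sequence satisfying $\sup_{n\ge1}\frac{n^2M_{n-1}}{M_n}<\infty$, and let $\phi:[0,1]\to[0,1]$ be analytic. If $\|\phi'\|_\infty\le 1$, then $\phi$ induces an endomorphism of $D([0,1],M)$.
   Context: A weight sequence is a sequence $(M_n)_{n\ge 0}$ of positive real numbers with $M_0=1$ and $\frac{M_{n+m}}{M_nM_m}\ge\binom{n+m}{m}$ for all non-negative integers $m,n$. It is non-analytic if $\lim_{n\to\infty}(n!/M_n)^{1/n}=0$. $D([0,1],M)$ is the set of complex-valued infinitely differentiable functions $f$ on $[0,1]$ (one-sided derivatives at endpoints) with $\|f\|_D=\sum_{n=0}^\infty \frac{\|f^{(n)}\|_\infty}{M_n}<\infty$, where $\|\cdot\|_\infty$ is the supremum norm on $[0,1]$; with pointwise operations and the norm $\|\cdot\|_D$ it is a unital commutative semisimple Banach algebra. An infinitely differentiable map $\phi:[0,1]\to[0,1]$ is called analytic if $\sup_{k\ge1}\left(\frac{\|\phi^{(k)}\|_\infty}{k!}\right)^{1/k}<\infty$. A map $\phi:[0,1]\to[0,1]$ induces an endomorphism of $D([0,1],M)$ if $f\circ\phi\in D([0,1],M)$ for every $f\in D([0,1],M)$. *)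

(* Defs.v *)
From Stdlib Require Import Reals Factorial Lra.
From Coquelicot Require Import Coquelicot.
Open Scope R_scope.

Definition I01 (x : R) : Prop := 0 <= x <= 1.

(* Functions on [0,1] are represented by total functions on R of which only
   the values on [0,1] are ever used. *)

(* [is_derive f x l] is [filterdiff f (locally x) (fun h => scal h l)]; here
   the increment is restricted to [0,1], which makes the derivative one-sided
   at 0 and at 1. *)
Definition is_derive01 {V : NormedModule R_AbsRing}
    (f : R -> V) (x : R) (l : V) : Prop :=
  filterdiff f (within I01 (locally x)) (fun h : R => scal h l).

(* Meaningful where a derivative exists, see [derive01_unique]. *)
Definition derive01 {V : CompleteNormedModule R_AbsRing}
    (f : R -> V) (x : R) : V :=
  iota (is_derive01 f x).

Definition derive01_n {V : CompleteNormedModule R_AbsRing}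
    (n : nat) (f : R -> V) : R -> V :=
  Nat.iter n derive01 f.

Definition smooth01 {V : CompleteNormedModule R_AbsRing} (f : R -> V) : Prop :=
  forall (n : nat) (x : R), I01 x ->
    exists l : V, is_derive01 (derive01_n n f) x l.

(* The coercion [real] sends an infinite supremum to 0, but the norm is only
   applied to iterated derivatives of smooth functions, which are bounded on
   [0,1]. *)
Definition supnorm {V : NormedModule R_AbsRing} (f : R -> V) : R :=
  real (Lub_Rbar (fun r : R => exists x : R, I01 x /\ r = norm (f x))).

(* [Rpower 0 y] is 1 in the library, hence the separate case. *)
Definition nth_root (n : nat) (x : R) : R :=
  if Rle_dec x 0 then 0 else Rpower x (/ INR n).

(* The binomial coefficient is qualified because [C] denotes the complex
   numbers of Coquelicot. *)
Definition weight_sequence (M : nat -> R) : Prop :=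
  (forall n : nat, 0 < M n) /\ M 0%nat = 1 /\
  forall m n : nat,
    M (n + m)%nat / (M n * M m) >= Binomial.C (n + m) m.

Definition non_analytic (M : nat -> R) : Prop :=
  is_lim_seq (fun n : nat => nth_root n (INR (fact n) / M n)) 0.

(* The canonical structure of [C] is that of a module over itself, so the real
   one has to be named. Its norm is the modulus, see [norm_C_R]. *)
Definition in_D (M : nat -> R) (f : R -> C_R_CompleteNormedModule) : Prop :=
  smooth01 f /\ ex_series (fun n : nat => supnorm (derive01_n n f) / M n).

Definition analytic (phi : R -> R) : Prop :=
  smooth01 (V := R_CompleteNormedModule) phi /\
  exists B : R, forall k : nat, (1 <= k)%nat ->
    nth_root k
      (supnorm (derive01_n (V := R_CompleteNormedModule) k phi)
         / INR (fact k)) <= B.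

Definition induces_endomorphism (M : nat -> R) (phi : R -> R) : Prop :=
  forall f : R -> C_R_CompleteNormedModule,
    in_D M f -> in_D M (fun x : R => f (phi x)).

Lemma norm_C_R (z : C_R_NormedModule) : norm z = Cmod z.
Proof.
destruct z as [a b]; unfold norm; simpl; unfold prod_norm, Cmod; simpl.
f_equal; unfold norm; simpl; unfold abs; simpl.
rewrite !Rmult_1_r, <- !Rabs_mult, !Rabs_pos_eq; auto; nra.
Qed.

Lemma is_derive01_inj {V : NormedModule R_AbsRing}
    (f : R -> V) (x : R) (l1 l2 : V) :
  I01 x -> is_derive01 f x l1 -> is_derive01 f x l2 -> l1 = l2.
Proof.
intros Hx [_ H1] [_ H2].
assert (L : is_filter_lim (within I01 (locally x)) x).
{ intros P HP. revert HP. unfold within; apply filter_imp; auto. }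
specialize (H1 x L); specialize (H2 x L).
assert (N : norm (minus l1 l2) = 0).
{ apply Rle_antisym; [|apply norm_ge_0].
  apply le_epsilon; intros e He; rewrite Rplus_0_l.
  assert (He2 : 0 < e / 2) by lra.
  generalize (H1 (mkposreal _ He2)) (H2 (mkposreal _ He2)); simpl.
  unfold within; intros K1 K2.
  destruct (filter_and _ _ K1 K2) as [d Hd].
  pose (t := Rmin (d / 2) (1 / 2)).
  assert (Ht : 0 < t /\ t <= d / 2 /\ t <= 1 / 2).
  { unfold t; destruct d as [d d0]; simpl.
    split; [apply Rmin_pos; lra | split; [apply Rmin_l | apply Rmin_r]]. }
  assert (E : exists h, Rabs h = t /\ I01 (x + h)).
  { unfold I01 in *; destruct (Rle_dec x (1 / 2)).
    - exists t; rewrite Rabs_pos_eq; lra.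
    - exists (- t); rewrite Rabs_Ropp, Rabs_pos_eq; lra. }
  destruct E as [h [Eh Ih]].
  assert (B : ball x d (x + h)).
  { unfold ball; simpl; unfold AbsRing_ball; simpl; unfold abs, minus, plus, opp;
    simpl.
    replace (x + h + - x) with h by ring. destruct d; simpl in *; lra. }
  destruct (Hd _ B) as [A1 A2]; specialize (A1 Ih); specialize (A2 Ih).
  assert (Eq : x + h + - x = h) by ring.
  change (@minus _ (x + h) x) with (x + h + - x) in A1, A2.
  rewrite Eq in A1, A2.
  set (u := minus (f (x + h)) (f x)) in *.
  assert (T : norm (scal h (minus l1 l2)) <= e * t).
  { assert (D : scal h (minus l1 l2) = minus (scal h l1) (scal h l2))
      by exact (scal_minus_distr_l (K := R_Ring) h l1 l2).
    rewrite D, (minus_trans u).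
    eapply Rle_trans; [apply (norm_triangle (V := V))|].
    rewrite <- (opp_minus u), (norm_opp (V := V)).
    change (norm h) with (Rabs h) in A1, A2. rewrite Eh in A1, A2.
    eapply Rle_trans; [apply Rplus_le_compat; [exact A1 | exact A2]|].
    apply Req_le; field. }
  assert (S : norm (minus l1 l2) = norm (scal (/ h) (scal h (minus l1 l2)))).
  { rewrite scal_assoc. change (mult (/ h) h) with (/ h * h).
    rewrite Rinv_l; [change 1 with (@one R_Ring); now rewrite scal_one|].
    intros Z; rewrite Z, Rabs_R0 in Eh; lra. }
  rewrite S. eapply Rle_trans; [apply (norm_scal (V := V))|].
  change (abs (/ h)) with (Rabs (/ h)). rewrite Rabs_inv, Eh.
  apply (Rmult_le_reg_l t); [lra|].
  rewrite <- Rmult_assoc, Rinv_r, Rmult_1_l; lra. }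
apply norm_eq_zero in N.
assert (K : plus (minus l1 l2) l2 = l1).
{ unfold minus. rewrite <- plus_assoc, plus_opp_l. apply plus_zero_r. }
rewrite <- K, N. apply plus_zero_l.
Qed.

Lemma derive01_unique {V : CompleteNormedModule R_AbsRing}
    (f : R -> V) (x : R) (l : V) :
  I01 x -> is_derive01 f x l -> derive01 f x = l.
Proof.
intros Hx Hl; apply iota_unique; auto.
intros y Hy; now apply (is_derive01_inj f x).
Qed.

(* Main.v *)
Require Import Defs.
From Stdlib Require Import Reals Factorial Lra Lia.
From Coquelicot Require Import Coquelicot.
Open Scope R_scope.

(* Writing [G_x(t) = sum_(j >= 1) phi^(j)(x) t^j / j!], Faa di Bruno's formula is
   (f o phi)^(n)(x) = sum_(m <= n) (n!/m!) [t^n](G_x^m) f^(m)(phi(x)), because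
   dG_x/dx = dG_x/dt - phi'(x). Hence ||f o phi||_D <= K ||f||_D as soon as
   K >= sum_n (n!/m!) [t^n](g^m) M_m / M_n for all m, where g is the power series
   with coefficients ||phi^(j)||/j!. The growth condition on M gives
   M_m / M_n <= B^(n-m) (m!/n!)^2, and m!/n! <= C_L (m + L)^-(n-m), so with
   s = B / (m + L) the sum is at most C_L s^-m g(s)^m. Analyticity and
   ||phi'|| <= 1 give g(s) <= s (1 + 2 A^2 s) when A s <= 1/2, which holds for L
   large, and then s^-m g(s)^m <= exp(2 A^2 s m) <= exp(2 A^2 B). *)

(** * Calculus of derivatives relative to [0,1] *)

Lemma is_filter_lim_within01 (x : R) : is_filter_lim (within I01 (locally x)) x.
Proof.
intros P HP. revert HP. unfold within; apply filter_imp; auto.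
Qed.

Lemma within01_proper (x : R) : I01 x -> ProperFilter (within I01 (locally x)).
Proof.
intros Hx; split; [|apply within_filter, locally_filter].
intros P HP; exists x; apply (locally_singleton x _ HP Hx).
Qed.

Lemma is_derive01_ext {V : NormedModule R_AbsRing}
    (f g : R -> V) (x : R) (l : V) :
  I01 x -> (forall t, I01 t -> f t = g t) ->
  is_derive01 f x l -> is_derive01 g x l.
Proof.
intros Hx E; pose proof (within01_proper x Hx) as PF.
apply filterdiff_ext_loc.
- exists (mkposreal 1 Rlt_0_1); intros y _; apply E.
(* [filterdiff_ext_loc] also asks for equality at each limit point of the filter; properness makes
   [x] the only one. *)
- intros y Hy.
  rewrite (is_filter_lim_unique (V := R_NormedModule) y x Hy (is_filter_lim_within01 x)); auto.
Qed.

Lemma is_derive01_value {V : NormedModule R_AbsRing}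
    (f : R -> V) (x : R) (l l' : V) :
  l = l' -> is_derive01 f x l -> is_derive01 f x l'.
Proof. now intros ->. Qed.

Lemma is_derive01_continuous {V : NormedModule R_AbsRing}
    (f : R -> V) (x : R) (l : V) :
  is_derive01 f x l -> filterlim f (within I01 (locally x)) (locally (f x)).
Proof.
intros Hf; apply filterdiff_continuous_aux.
- now exists (fun h => scal h l).
- apply is_filter_lim_within01.
Qed.

Lemma is_derive01_const {V : NormedModule R_AbsRing}
    (a : V) (x : R) : is_derive01 (fun _ => a) x zero.
Proof.
apply (filterdiff_ext_lin _ (fun _ => zero)).
- apply filterdiff_const.
- intros h; symmetry; apply (scal_zero_r (V := V)).
Qed.

Lemma is_derive01_plus {V : NormedModule R_AbsRing}
    (f g : R -> V) (x : R) (lf lg : V) :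
  is_derive01 f x lf -> is_derive01 g x lg ->
  is_derive01 (fun t => plus (f t) (g t)) x (plus lf lg).
Proof.
intros Hf Hg.
eapply filterdiff_ext_lin; [exact (filterdiff_plus_fct _ _ _ _ Hf Hg)|].
intros h; symmetry; apply (scal_distr_l (V := V)).
Qed.

Lemma is_derive01_scal {V : NormedModule R_AbsRing}
    (f : R -> R) (g : R -> V) (x : R) (lf : R) (lg : V) :
  I01 x -> is_derive01 (V := R_NormedModule) f x lf -> is_derive01 g x lg ->
  is_derive01 (fun t => scal (f t) (g t)) x
    (plus (scal lf (g x)) (scal (f x) lg)).
Proof.
intros Hx Hf Hg; pose proof (within01_proper x Hx) as PF.
eapply filterdiff_ext_lin.
- eapply (filterdiff_comp_2 f g (fun a b => scal a b) _ _
    (fun a b => plus (scal a (g x)) (scal (f x) b))); [exact Hf | exact Hg |].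
  (* The differential of the product is needed along the image filter of [t => (f t, g t)], which
     tends to [(f x, g x)] because both factors are continuous. *)
  apply (filterdiff_scal (f x, g x)); [|exact Rmult_comm].
  intros P HP.
  apply (filterlim_pair f g (is_derive01_continuous (V := R_NormedModule) _ _ _ Hf)
    (is_derive01_continuous _ _ _ Hg)).
  destruct HP as [e He].
  exists (ball (f x) e) (ball (g x) e); try apply locally_ball.
  intros u v Hu Hv; apply He; now split.
- intros h; simpl.
  rewrite (scal_distr_l (V := V)), !(scal_assoc (V := V)).
  do 2 f_equal; apply Rmult_comm.
Qed.

(** Since [f] maps [0,1] into itself, increments of [f] at [x] stay admissible for the relative
    derivative of [g] at [f x], even when [f x] is an endpoint. *)
Lemma is_derive01_comp {V : NormedModule R_AbsRing}
    (f : R -> R) (g : R -> V) (x : R) (lf : R) (lg : V) :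
  I01 x -> (forall t, I01 t -> I01 (f t)) ->
  is_derive01 (V := R_NormedModule) f x lf -> is_derive01 g (f x) lg ->
  is_derive01 (fun t => g (f t)) x (scal lf lg).
Proof.
intros Hx Hmap Hf Hg; pose proof (within01_proper x Hx) as PF.
assert (LE : filter_le (filtermap f (within I01 (locally x)))
               (within I01 (locally (f x)))).
{ intros P HP.
  pose proof (is_derive01_continuous (V := R_NormedModule) _ _ _ Hf _ HP) as K.
  unfold filtermap, within in *; revert K; apply filter_imp; auto. }
eapply filterdiff_ext_lin.
- apply (filterdiff_comp f g _ (fun h => scal h lg) Hf).
  destruct Hg as [Hlin Hdom]; split; [exact Hlin|].
  intros y Hy.
  assert (y = f x) as ->.
  { apply (is_filter_lim_unique (V := R_NormedModule) y (f x) Hy).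
    apply (is_filter_lim_filter_le _ LE), is_filter_lim_within01. }
  apply (is_domin_le _ _ (Hdom _ (is_filter_lim_within01 (f x))) LE).
- intros h; simpl; symmetry; apply (scal_assoc (V := V)).
Qed.

Lemma is_derive01_sum_n {V : NormedModule R_AbsRing}
    (u : nat -> R -> V) (l : nat -> V) (x : R) (n : nat) :
  (forall k, (k <= n)%nat -> is_derive01 (u k) x (l k)) ->
  is_derive01 (fun t => sum_n (fun k => u k t) n) x (sum_n l n).
Proof.
induction n as [|n IH]; intros H.
- rewrite sum_O.
  apply (filterdiff_ext (u 0%nat)); [intros t; now rewrite sum_O|].
  now apply H.
- rewrite sum_Sn.
  apply (filterdiff_ext (fun t => plus (sum_n (fun k => u k t) n) (u (S n) t))).
  { intros t; now rewrite sum_Sn. }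
  apply is_derive01_plus; [apply IH; auto | apply H; auto].
Qed.

(** * Boundedness on [0,1] and the supremum norm *)

Lemma continuous01_norm_bounded {V : NormedModule R_AbsRing}
    (f : R -> V) :
  (forall x, I01 x -> filterlim f (within I01 (locally x)) (locally (f x))) ->
  exists B, forall x, I01 x -> norm (f x) <= B.
Proof.
intros Hf.
(* Composing with this retraction of the line onto [0,1] turns relative continuity into two-sided
   continuity, as the extreme value theorem requires at the endpoints. *)
pose (clamp := fun x : R => Rmax 0 (Rmin x 1)).
assert (Hc : forall x, I01 (clamp x)).
{ intros x; unfold clamp, I01, Rmax, Rmin; repeat destruct Rle_dec; lra. }
assert (Hid : forall x, I01 x -> clamp x = x).
{ intros x; unfold clamp, I01, Rmax, Rmin; repeat destruct Rle_dec; lra. }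
destruct (continuity_ab_maj (fun x => norm (f (clamp x))) 0 1) as [X [HX _]].
- lra.
- intros x Ix; apply continuity_pt_filterlim.
  apply (filterlim_comp _ _ _ (fun t => f (clamp t)) norm _ (locally (f (clamp x))));
    [|apply (filterlim_norm (V := V))].
  apply (filterlim_comp _ _ _ clamp f _ (within I01 (locally (clamp x))));
    [|now apply Hf].
  rewrite (Hid x Ix); intros P [d Hd].
  exists d; intros y Hy; apply Hd; [|apply Hc].
  revert Hy; unfold ball; simpl; unfold AbsRing_ball, abs, minus, plus, opp; simpl.
  unfold clamp, I01, Rmax, Rmin in *; repeat destruct Rle_dec;
    unfold Rabs; repeat destruct Rcase_abs; lra.
- exists (norm (f (clamp X))); intros x Ix.
  specialize (HX x Ix); rewrite (Hid x Ix) in HX; exact HX.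
Qed.

Lemma supnorm_le {V : NormedModule R_AbsRing}
    (f : R -> V) (b : R) :
  (forall x, I01 x -> norm (f x) <= b) -> supnorm f <= b.
Proof.
intros Hb; unfold supnorm.
destruct (Lub_Rbar_correct (fun r => exists x, I01 x /\ r = norm (f x)))
  as [Hub Hleast].
specialize (Hleast (Finite b)).
assert (I0 : I01 0) by (unfold I01; lra).
specialize (Hub (norm (f 0)) (ex_intro _ 0 (conj I0 eq_refl))).
destruct Lub_Rbar as [r| |]; simpl in *.
- apply Hleast; intros y [x [Ix ->]]; simpl; now apply Hb.
- exfalso; apply Hleast; intros y [x [Ix ->]]; simpl; now apply Hb.
- contradiction.
Qed.

(** The bound [b] excludes an infinite supremum, which [supnorm] would read as 0. *)
Lemma supnorm_ge {V : NormedModule R_AbsRing}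
    (f : R -> V) (b x : R) :
  (forall t, I01 t -> norm (f t) <= b) -> I01 x -> norm (f x) <= supnorm f.
Proof.
intros Hb Ix; unfold supnorm.
destruct (Lub_Rbar_correct (fun r => exists x, I01 x /\ r = norm (f x)))
  as [Hub Hleast].
specialize (Hub (norm (f x)) (ex_intro _ x (conj Ix eq_refl))).
specialize (Hleast (Finite b)).
destruct Lub_Rbar as [r| |]; simpl in *; try easy.
exfalso; apply Hleast; intros y [t [It ->]]; simpl; now apply Hb.
Qed.

Lemma supnorm_nonneg {V : NormedModule R_AbsRing}
    (f : R -> V) : 0 <= supnorm f.
Proof.
unfold supnorm.
destruct (Lub_Rbar_correct (fun r => exists x, I01 x /\ r = norm (f x)))
  as [Hub _].
assert (I0 : I01 0) by (unfold I01; lra).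
specialize (Hub (norm (f 0)) (ex_intro _ 0 (conj I0 eq_refl))).
pose proof (norm_ge_0 (f 0)).
destruct Lub_Rbar as [r| |]; simpl in *; lra.
Qed.

(** * Iterated derivatives of smooth functions *)

Lemma smooth01_derive {V : CompleteNormedModule R_AbsRing}
    (f : R -> V) (n : nat) (x : R) :
  smooth01 f -> I01 x ->
  is_derive01 (derive01_n n f) x (derive01_n (S n) f x).
Proof.
intros Hf Ix; destruct (Hf n x Ix) as [l Hl].
change (derive01_n (S n) f x) with (derive01 (derive01_n n f) x).
now rewrite (derive01_unique _ _ _ Ix Hl).
Qed.

(** Each iterated derivative is differentiable, hence continuous and bounded on [0,1]. *)
Lemma smooth01_le_supnorm {V : CompleteNormedModule R_AbsRing}
    (f : R -> V) (n : nat) (x : R) :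
  smooth01 f -> I01 x -> norm (derive01_n n f x) <= supnorm (derive01_n n f).
Proof.
intros Hf Ix.
destruct (continuous01_norm_bounded (derive01_n n f)) as [B HB].
- intros t It; apply (is_derive01_continuous _ _ _ (smooth01_derive f n t Hf It)).
- now apply (supnorm_ge _ B).
Qed.

(** Smoothness is proved by exhibiting candidates for all derivatives; below, the candidates are the
    sums in Faa di Bruno's formula. *)
Lemma derive01_n_chain {V : CompleteNormedModule R_AbsRing}
    (f : R -> V) (u : nat -> R -> V) :
  (forall x, I01 x -> u 0%nat x = f x) ->
  (forall n x, I01 x -> is_derive01 (u n) x (u (S n) x)) ->
  smooth01 f /\ forall n x, I01 x -> derive01_n n f x = u n x.
Proof.
intros H0 HS.
assert (E : forall n x, I01 x -> derive01_n n f x = u n x).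
{ induction n as [|n IH]; intros x Ix; [symmetry; now apply H0|].
  change (derive01_n (S n) f x) with (derive01 (derive01_n n f) x).
  apply derive01_unique; auto.
  apply (is_derive01_ext (u n)); auto.
  intros t It; symmetry; auto. }
split; auto.
intros n x Ix; exists (u (S n) x).
apply (is_derive01_ext (u n)); auto.
intros t It; symmetry; auto.
Qed.

(** * Coefficients of powers of a power series *)

(* The coefficient of [t^n] in [(sum_j y_j t^j)^m]. *)
Fixpoint conv_pow (y : nat -> R) (m : nat) : nat -> R :=
  match m with
  | O => fun n => match n with O => 1 | S _ => 0 end
  | S m' => PS_mult (conv_pow y m') y
  end.

Lemma conv_pow_eq0 (y : nat -> R) (m n : nat) :
  y 0%nat = 0 -> (n < m)%nat -> conv_pow y m n = 0.
Proof.
intros y0; revert n; induction m as [|m IH]; intros n Hn; [lia|].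
simpl; unfold PS_mult; rewrite <- (Rmult_0_r (INR (S n))), Rmult_comm, <- sum_cte.
apply sum_eq; intros k Hk.
destruct (Nat.eq_dec k n) as [->|].
- rewrite Nat.sub_diag, y0; ring.
- rewrite IH by lia; ring.
Qed.

Lemma conv_pow_nonneg (y : nat -> R) (m n : nat) :
  (forall j, 0 <= y j) -> 0 <= conv_pow y m n.
Proof.
intros Hy; revert n; induction m as [|m IH]; intros n.
- destruct n; simpl; lra.
- apply cond_pos_sum; intros k; now apply Rmult_le_pos.
Qed.

(** These coefficients are polynomials in the [y j] with nonnegative coefficients, so majorants pass
    through. *)
Lemma Rabs_conv_pow_le (y z : nat -> R) (m n : nat) :
  (forall j, Rabs (y j) <= z j) -> Rabs (conv_pow y m n) <= conv_pow z m n.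
Proof.
intros Hyz; revert n; induction m as [|m IH]; intros n.
- destruct n; simpl; [rewrite Rabs_R1|rewrite Rabs_R0]; lra.
- simpl; unfold PS_mult; eapply Rle_trans; [apply Rsum_abs|].
  apply sum_Rle; intros k Hk; rewrite Rabs_mult.
  apply Rmult_le_compat; auto using Rabs_pos.
Qed.

(** Both sides sum [G i j] over the triangle i + j <= N. *)
Lemma sum_f_R0_triangle (G : nat -> nat -> R) (N : nat) :
  sum_f_R0 (fun n => sum_f_R0 (fun k => G k (n - k)%nat) n) N
  = sum_f_R0 (fun k => sum_f_R0 (G k) (N - k)) N.
Proof.
induction N as [|N IH]; [reflexivity|].
rewrite !tech5, IH, Nat.sub_diag; simpl (sum_f_R0 (G (S N)) 0).
rewrite <- Rplus_assoc, <- sum_plus; f_equal.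
apply sum_eq; intros k Hk.
now replace (S N - k)%nat with (S (N - k)) by lia.
Qed.

Lemma sum_f_R0_le_le (u : nat -> R) (n N : nat) :
  (forall j, 0 <= u j) -> (n <= N)%nat -> sum_f_R0 u n <= sum_f_R0 u N.
Proof.
intros Hu; induction 1 as [|N _ IH]; [lra|].
rewrite tech5; specialize (Hu (S N)); lra.
Qed.

(** The left side keeps only the products of total degree at most [N] in the expansion of the right
    side; the remaining products are nonnegative. *)
Lemma sum_conv_pow_le (y : nat -> R) (s : R) (m N : nat) :
  (forall j, 0 <= y j) -> 0 <= s ->
  sum_f_R0 (fun n => conv_pow y m n * s ^ n) N
  <= (sum_f_R0 (fun j => y j * s ^ j) N) ^ m.
Proof.
intros Hy Hs; pose proof (fun j => pow_le s j Hs) as Hp.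
induction m as [|m IH].
- apply Req_le; induction N as [|N IHN]; [simpl; ring|].
  rewrite tech5, IHN; simpl; ring.
- eapply Rle_trans;
    [|simpl; rewrite Rmult_comm; apply Rmult_le_compat_r; [|exact IH]].
  2: { apply cond_pos_sum; intros j; now apply Rmult_le_pos. }
  rewrite (sum_eq _ (fun n => sum_f_R0 (fun k =>
    (fun i j => (conv_pow y m i * s ^ i) * (y j * s ^ j)) k (n - k)%nat) n)).
  2: { intros n Hn; simpl; unfold PS_mult; rewrite Rmult_comm, scal_sum.
       apply sum_eq; intros k Hk; replace (s ^ n) with (s ^ k * s ^ (n - k)).
       - ring.
       - rewrite <- pow_add; f_equal; lia. }
  rewrite (sum_f_R0_triangle (fun i j => (conv_pow y m i * s ^ i) * (y j * s ^ j))).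
  rewrite Rmult_comm, scal_sum.
  apply sum_Rle; intros k Hk.
  rewrite (sum_eq _ (fun j => y j * s ^ j * (conv_pow y m k * s ^ k))) by (intros; ring).
  rewrite <- scal_sum; apply Rmult_le_compat_l.
  { apply Rmult_le_pos; auto using conv_pow_nonneg. }
  apply sum_f_R0_le_le; [|lia]; intros j; now apply Rmult_le_pos.
Qed.

(** Leibniz rule for d/dt, read off at t^n. The weight n + 1 splits as i + (n + 1 - i), and each
    part vanishes at one end of the sum. *)
Lemma PS_mult_succ (a y : nat -> R) (n : nat) :
  sum_f_R0 (fun k => INR (S k) * a (S k) * y (n - k)%nat
                     + a k * (INR (S (n - k)) * y (S (n - k)))) n
  = INR (S n) * PS_mult a y (S n).
Proof.
rewrite sum_plus; unfold PS_mult; rewrite scal_sum.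
rewrite (sum_eq (fun i => a i * y (S n - i)%nat * INR (S n))
  (fun i => INR i * a i * y (S n - i)%nat + a i * (INR (S n - i) * y (S n - i)%nat))).
2: { intros i Hi; rewrite minus_INR by lia; ring. }
rewrite sum_plus, (decomp_sum (fun i => INR i * a i * _)), (tech5 _ n) by lia.
rewrite Nat.sub_diag; simpl pred; simpl (INR 0).
replace (sum_f_R0 (fun i => a i * (INR (S n - i) * y (S n - i)%nat)) n)
  with (sum_f_R0 (fun k => a k * (INR (S (n - k)) * y (S (n - k)))) n).
2: { apply sum_eq; intros k Hk; now replace (S n - k)%nat with (S (n - k)) by lia. }
simpl Nat.sub; ring.
Qed.

Lemma sum_f_R0_diag (a : nat -> R) (c : R) (n : nat) :
  sum_f_R0 (fun k => a k * match (n - k)%nat with O => c | S _ => 0 end) n = a n * c.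
Proof.
destruct n as [|n]; [reflexivity|].
rewrite tech5, Nat.sub_diag, (sum_eq _ (fun _ => 0)), sum_cte; [ring|].
intros k Hk; replace (S n - k)%nat with (S (n - k)) by lia; ring.
Qed.

(* With [G = sum_j y_j t^j], the hypothesis reads [dG/dx = dG/dt - y_1], and the
   conclusion is the coefficient of [t^n] in [d(G^m)/dx = d(G^m)/dt - m y_1 G^(m-1)]. *)
Lemma is_derive01_conv_pow (y : nat -> R -> R) (x : R) :
  I01 x ->
  (forall j, is_derive01 (V := R_NormedModule) (y j) x
     (INR (S j) * y (S j) x - match j with O => y 1%nat x | S _ => 0 end)) ->
  forall m n,
  is_derive01 (V := R_NormedModule) (fun t => conv_pow (fun j => y j t) m n) x
    (INR (S n) * conv_pow (fun j => y j x) m (S n)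
     - INR m * y 1%nat x * conv_pow (fun j => y j x) (pred m) n).
Proof.
intros Ix Hy; induction m as [|m IH]; intros n.
- eapply is_derive01_value;
    [|exact (is_derive01_const (V := R_NormedModule) (conv_pow (fun _ => 0) 0 n) x)].
  change (@zero R_NormedModule) with 0; simpl; ring.
- apply (filterdiff_ext (V := R_NormedModule) (fun t =>
    sum_n (fun k => conv_pow (fun j => y j t) m k * y (n - k)%nat t) n)).
  { intros t; now rewrite sum_n_Reals. }
  eapply is_derive01_value.
  2: { apply (is_derive01_sum_n (V := R_NormedModule)
         (fun k t => conv_pow (fun j => y j t) m k * y (n - k)%nat t)).
       intros k Hk.
       exact (is_derive01_scal (V := R_NormedModule) _ _ _ _ _ Ix (IH k) (Hy (n - k)%nat)). }
  rewrite sum_n_Reals.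
  set (Q := fun m => conv_pow (fun j => y j x) m).
  (* The three groups are the coefficients of t^n in d(G^m G)/dt, in m y_1 G^(m-1) G and in y_1
     G^m. *)
  transitivity (sum_f_R0 (fun k =>
     ((INR (S k) * Q m (S k) * y (n - k)%nat x
                     + Q m k * (INR (S (n - k)) * y (S (n - k)) x))
     - (Q (pred m) k * y (n - k)%nat x) * (INR m * y 1%nat x))
     - Q m k * match (n - k)%nat with O => y 1%nat x | S _ => 0 end) n).
  { apply sum_eq; intros k Hk; unfold plus, scal; simpl; unfold mult; simpl.
    fold (Q m) (Q (pred m)); ring. }
  rewrite !minus_sum, sum_f_R0_diag, (PS_mult_succ (Q m) (fun j => y j x)).
  rewrite <- (scal_sum (fun k => Q (pred m) k * y (n - k)%nat x)).
  fold (PS_mult (Q (pred m)) (fun j => y j x) n).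
  change (PS_mult (Q (pred m)) (fun j => y j x)) with (Q (S (pred m))).
  change (PS_mult (Q m) (fun j => y j x)) with (Q (S m)).
  fold (Q m) (Q (S m)).
  match goal with |- @eq _ ?a ?b => change (@eq R a b) end.
  (* For m = 0 the exponent [S (pred m)] is 1 instead of 0, but its coefficient [INR m] vanishes. *)
  rewrite (S_INR n), (S_INR m); destruct m as [|m]; simpl pred; [simpl INR|]; ring.
Qed.

(** * Faa di Bruno's formula *)

(* The constant term is dropped: these are the coefficients of [phi(x + t) - phi(x)]. *)
Definition taylor_coef (phi : R -> R) (j : nat) (x : R) : R :=
  match j with
  | O => 0
  | S _ => derive01_n (V := R_CompleteNormedModule) j phi x / INR (fact j)
  end.

(** This is dG/dx = dG/dt - phi'(x), coefficient by coefficient; for j = 0 the two terms cancel, in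
    accordance with the dropped constant term. *)
Lemma is_derive01_taylor_coef (phi : R -> R) (j : nat) (x : R) :
  smooth01 (V := R_CompleteNormedModule) phi -> I01 x ->
  is_derive01 (V := R_NormedModule) (taylor_coef phi j) x
    (INR (S j) * taylor_coef phi (S j) x
     - match j with O => taylor_coef phi 1 x | S _ => 0 end).
Proof.
intros Hphi Ix; destruct j as [|j].
- eapply is_derive01_value; [|exact (is_derive01_const (V := R_NormedModule) 0 x)].
  simpl INR; change (0 = 1 * taylor_coef phi 1 x - taylor_coef phi 1 x); ring.
- pose proof (is_derive01_scal (V := R_NormedModule) _ _ x _ _ Ix
    (is_derive01_const (V := R_NormedModule) (/ INR (fact (S j))) x)
    (smooth01_derive phi (S j) x Hphi Ix)) as H.
  apply (filterdiff_ext (V := R_NormedModule) (fun t =>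
    / INR (fact (S j)) * derive01_n (V := R_CompleteNormedModule) (S j) phi t)).
  { intros t; apply Rmult_comm. }
  eapply is_derive01_value; [|exact H].
  set (a := derive01_n (S j) phi x); set (b := derive01_n (S (S j)) phi x).
  change (0 * a + / INR (fact (S j)) * b
    = INR (S (S j)) * (b / INR (fact (S (S j)))) - 0).
  rewrite (fact_simpl (S j)), mult_INR.
  field; split; [apply INR_fact_neq_0 | apply not_0_INR; discriminate].
Qed.

Section Composition.

Context {V : CompleteNormedModule R_AbsRing} (f : R -> V) (phi : R -> R)
  (Hf : smooth01 f) (Hphi : smooth01 (V := R_CompleteNormedModule) phi)
  (Hmap : forall x, I01 x -> I01 (phi x)).

(* The partial Bell polynomial in the derivatives of [phi] at [x]. *)
Definition bell (n m : nat) (x : R) : R :=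
  INR (fact n) / INR (fact m) * conv_pow (fun j => taylor_coef phi j x) m n.

Lemma bell_eq0 (n m : nat) (x : R) : (n < m)%nat -> bell n m x = 0.
Proof. intros H; unfold bell; rewrite conv_pow_eq0; auto; ring. Qed.

(** Rearranged, this is the recurrence B(n+1,m) = dB(n,m)/dx + phi' B(n,m-1). The normalization
    n!/m! absorbs the factors n + 1 and m from [is_derive01_conv_pow]. *)
Lemma is_derive01_bell (n m : nat) (x : R) :
  I01 x ->
  is_derive01 (V := R_NormedModule) (bell n m) x
    (bell (S n) m x - derive01_n (V := R_CompleteNormedModule) 1 phi x
       * match m with O => 0 | S m' => bell n m' x end).
Proof.
intros Ix.
pose proof (is_derive01_scal (V := R_NormedModule) _ _ x _ _ Ix
  (is_derive01_const (V := R_NormedModule) (INR (fact n) / INR (fact m)) x)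
  (is_derive01_conv_pow (taylor_coef phi) x Ix
     (fun j => is_derive01_taylor_coef phi j x Hphi Ix) m n)) as H.
eapply is_derive01_value; [|exact H].
unfold bell; set (Q := conv_pow (fun j => taylor_coef phi j x)).
change (0 * Q m n + INR (fact n) / INR (fact m) *
  (INR (S n) * Q m (S n) - INR m * (derive01_n (V := R_CompleteNormedModule) 1 phi x / 1)
     * Q (pred m) n) = INR (fact (S n)) / INR (fact m) * Q m (S n) -
  derive01_n (V := R_CompleteNormedModule) 1 phi x *
  match m with O => 0 | S m' => INR (fact n) / INR (fact m') * Q m' n end).
rewrite (fact_simpl n), mult_INR.
destruct m as [|m].
- simpl (INR 0); simpl (fact 0); field; simpl; lra.
- rewrite (fact_simpl m), mult_INR; simpl pred; field.
  split; [apply INR_fact_neq_0 | apply not_0_INR; discriminate].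
Qed.

(** Here [P], [P'] stand for B(n,.), B(n+1,.), [G m] for f^(m) at phi(x) and [d] for phi'(x). The
    correction in the derivative of B(n,m) cancels the chain rule term of index m - 1, so only the
    last chain rule term survives. *)
Lemma sum_n_telescope (P P' : nat -> R) (G : nat -> V) (d : R) (K : nat) :
  sum_n (fun m => plus
      (scal (P' m - d * match m with O => 0 | S m' => P m' end) (G m))
      (scal (P m) (scal d (G (S m))))) K
  = plus (sum_n (fun m => scal (P' m) (G m)) K) (scal (d * P K) (G (S K))).
Proof.
assert (Hs : forall (r s : R) (v : V), scal r (scal s v) = scal (s * r) v).
{ intros r s v; rewrite scal_assoc, Rmult_comm; reflexivity. }
induction K as [|K IH].
- rewrite !sum_O, Hs; do 2 f_equal; simpl; ring.
- rewrite !sum_Sn, IH, Hs, <- !plus_assoc; f_equal.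
  rewrite !plus_assoc; f_equal.
  rewrite plus_comm.
  unfold Rminus; rewrite (scal_distr_r (P' (S K))), <- plus_assoc.
  rewrite <- (scal_distr_r (- (d * P K))).
  change (plus (- (d * P K)) (d * P K)) with (- (d * P K) + d * P K).
  rewrite Rplus_opp_l.
  change 0 with (@zero R_Ring); rewrite scal_zero_l; apply plus_zero_r.
Qed.

Definition comp_derive (n : nat) (x : R) : V :=
  sum_n (fun m => scal (bell n m x) (derive01_n m f (phi x))) n.

(** Padding with a zero term lets the sums of orders n and n + 1 range over the same indices. *)
Lemma comp_derive_succ (n : nat) (x : R) :
  comp_derive n x = sum_n (fun m => scal (bell n m x) (derive01_n m f (phi x))) (S n).
Proof.
rewrite sum_Sn, bell_eq0 by lia.
change 0 with (@zero R_Ring); rewrite scal_zero_l; symmetry; apply plus_zero_r.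
Qed.

Lemma is_derive01_comp_derive (n : nat) (x : R) :
  I01 x -> is_derive01 (comp_derive n) x (comp_derive (S n) x).
Proof.
intros Ix.
apply (filterdiff_ext (fun t =>
  sum_n (fun m => scal (bell n m t) (derive01_n m f (phi t))) (S n))).
{ intros t; symmetry; apply comp_derive_succ. }
assert (Hd : forall m, is_derive01 (fun t => derive01_n m f (phi t)) x
  (scal (derive01_n (V := R_CompleteNormedModule) 1 phi x) (derive01_n (S m) f (phi x)))).
{ intros m; apply (is_derive01_comp phi (derive01_n m f) x _ _ Ix Hmap).
  - exact (smooth01_derive phi 0 x Hphi Ix).
  - apply (smooth01_derive f m (phi x) Hf (Hmap x Ix)). }
eapply is_derive01_value; [|exact (is_derive01_sum_n _ _ x (S n)
  (fun m _ => is_derive01_scal _ _ x _ _ Ix (is_derive01_bell n m x Ix) (Hd m)))].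
rewrite (sum_n_telescope (fun m => bell n m x) (fun m => bell (S n) m x)
  (fun m => derive01_n m f (phi x))).
(* The surviving boundary term carries the factor B(n,n+1) = 0. *)
rewrite (bell_eq0 n (S n)), Rmult_0_r by lia.
change 0 with (@zero R_Ring); rewrite scal_zero_l; apply plus_zero_r.
Qed.

Lemma smooth01_comp :
  smooth01 (fun x => f (phi x)) /\
  forall n x, I01 x -> derive01_n n (fun x => f (phi x)) x = comp_derive n x.
Proof.
apply derive01_n_chain; [|exact is_derive01_comp_derive].
intros x Ix; unfold comp_derive, bell; rewrite sum_O; simpl.
replace (1 / 1 * 1) with 1 by field; apply (scal_one (K := R_Ring)).
Qed.

End Composition.

(** * Elementary inequalities, double sums and nonnegative series *)

Lemma nth_root_le (k : nat) (r a : R) :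
  (1 <= k)%nat -> 0 <= a -> nth_root k r <= a -> r <= a ^ k.
Proof.
intros Hk Ha; unfold nth_root; destruct (Rle_dec r 0) as [Hr|Hr]; intros H.
- pose proof (pow_le a k Ha); lra.
- replace r with (Rpower r (/ INR k) ^ k).
  + apply pow_incr; split; [|exact H]; apply Rlt_le, exp_pos.
  + rewrite <- Rpower_pow, Rpower_mult, Rinv_l, Rpower_1; [reflexivity|lra| |apply exp_pos].
    apply not_0_INR; lia.
Qed.

Lemma pow_one_plus_le_exp (x : R) (m : nat) : 0 <= x -> (1 + x) ^ m <= exp (INR m * x).
Proof.
intros Hx; replace (exp (INR m * x)) with (exp x ^ m).
- apply pow_incr; split; [lra|apply exp_ineq1_le].
- induction m as [|m IH]; [simpl; now rewrite Rmult_0_l, exp_0|].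
  rewrite S_INR, Rmult_plus_distr_r, exp_plus, <- IH, Rmult_1_l; simpl; ring.
Qed.

(* The factor [m + L] exceeds [m + i] only for [i < L], and then by a ratio of at
   most [L + 1]. *)
Lemma fact_mul_pow_le (L m k : nat) :
  INR (fact m) * (INR m + INR L) ^ k <= (INR L + 1) ^ L * INR (fact (m + k)).
Proof.
(* The induction pays a factor L + 1 only while k < L, hence the exponent [Nat.min k L]; it is then
   replaced by [L] to make the constant independent of k. *)
assert (H : (fact m * (m + L) ^ k <= (L + 1) ^ (Nat.min k L) * fact (m + k))%nat).
{ induction k as [|k IH]; [simpl; rewrite !Nat.add_0_r; lia|].
  rewrite (Nat.add_succ_r m k); change (fact (S (m + k))) with ((S (m + k)) * fact (m + k))%nat.
  rewrite Nat.pow_succ_r'.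
  destruct (Nat.le_gt_cases L k) as [HL|HL].
  - rewrite (Nat.min_r k L) in IH by lia; rewrite (Nat.min_r (S k) L) by lia.
    pose proof (Nat.mul_le_mono _ _ (m + L) (S (m + k)) IH ltac:(lia)); lia.
  - rewrite (Nat.min_l k L) in IH by lia; rewrite (Nat.min_l (S k) L), Nat.pow_succ_r' by lia.
    pose proof (Nat.mul_le_mono _ _ (m + L) ((L + 1) * S (m + k)) IH ltac:(nia)); lia. }
assert (H' : (fact m * (m + L) ^ k <= (L + 1) ^ L * fact (m + k))%nat).
{ eapply Nat.le_trans; [exact H|].
  apply Nat.mul_le_mono_r, Nat.pow_le_mono_r; lia. }
apply le_INR in H'; rewrite !mult_INR, !pow_INR, !plus_INR in H'; exact H'.
Qed.

Lemma sum_f_R0_exchange (u : nat -> nat -> R) (n m : nat) :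
  sum_f_R0 (fun i => sum_f_R0 (u i) m) n = sum_f_R0 (fun j => sum_f_R0 (fun i => u i j) n) m.
Proof.
induction n as [|n IH]; [reflexivity|].
rewrite tech5, IH, <- sum_plus; reflexivity.
Qed.

Lemma ex_series_nonneg_bounded (a : nat -> R) (b : R) :
  (forall n, 0 <= a n) -> (forall n, sum_f_R0 a n <= b) -> ex_series a.
Proof.
intros Ha Hb.
destruct (ex_finite_lim_seq_incr (sum_n a) b) as [l Hl].
- intros n; rewrite sum_Sn; unfold plus; simpl; specialize (Ha (S n)); lra.
- intros n; rewrite sum_n_Reals; apply Hb.
- now exists l.
Qed.

Lemma ex_series_nonneg_bound (a : nat -> R) :
  (forall n, 0 <= a n) -> ex_series a -> exists b, forall n, sum_f_R0 a n <= b.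
Proof.
intros Ha [l Hl]; exists l; intros n; rewrite <- sum_n_Reals.
apply (is_lim_seq_incr_compare (sum_n a) l Hl).
intros k; rewrite sum_Sn; unfold plus; simpl; specialize (Ha (S k)); lra.
Qed.

Lemma norm_sum_n_le {V : NormedModule R_AbsRing} (u : nat -> V) (n : nat) :
  norm (sum_n u n) <= sum_f_R0 (fun k => norm (u k)) n.
Proof.
rewrite <- sum_n_Reals; apply (norm_sum_n_m (V := V)).
Qed.

(** * A majorant uniform in x, and the weighted estimate *)

Definition sup_taylor_coef (phi : R -> R) (j : nat) : R :=
  match j with
  | O => 0
  | S _ => supnorm (derive01_n (V := R_CompleteNormedModule) j phi) / INR (fact j)
  end.

Lemma sup_taylor_coef_nonneg (phi : R -> R) (j : nat) : 0 <= sup_taylor_coef phi j.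
Proof.
destruct j; [simpl; lra|]; apply Rmult_le_pos; [apply supnorm_nonneg|].
apply Rlt_le, Rinv_0_lt_compat, INR_fact_lt_0.
Qed.

Lemma Rabs_taylor_coef_le (phi : R -> R) (j : nat) (x : R) :
  smooth01 (V := R_CompleteNormedModule) phi -> I01 x ->
  Rabs (taylor_coef phi j x) <= sup_taylor_coef phi j.
Proof.
intros Hphi Ix; destruct j as [|j]; [simpl; rewrite Rabs_R0; lra|].
pose proof (INR_fact_lt_0 (S j)) as Hj.
unfold taylor_coef, sup_taylor_coef, Rdiv.
rewrite Rabs_mult, (Rabs_pos_eq (/ _)) by now apply Rlt_le, Rinv_0_lt_compat.
apply Rmult_le_compat_r; [now apply Rlt_le, Rinv_0_lt_compat|].
exact (smooth01_le_supnorm (V := R_CompleteNormedModule) phi (S j) x Hphi Ix).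
Qed.

(** The linear term is at most s, and the terms from j = 2 on are at most the geometric tail (as)^2
    / (1 - as) <= 2 (as)^2. *)
Lemma sum_geometric_tail_le (z : nat -> R) (a s : R) (N : nat) :
  z 0%nat = 0 -> z 1%nat <= 1 -> (forall j, (1 <= j)%nat -> z j <= a ^ j) ->
  0 <= a -> 0 <= s -> a * s <= 1 / 2 ->
  sum_f_R0 (fun j => z j * s ^ j) N <= s * (1 + 2 * a ^ 2 * s).
Proof.
intros z0 z1 Hz Ha Hs Has.
assert (Hq : 0 <= a * s) by now apply Rmult_le_pos.
(* The added reserve 2 q^(K+2), with q = as, pays for all later terms: q <= 1/2 gives q^n + 2
   q^(n+1) <= 2 q^n. *)
assert (H : forall K, sum_f_R0 (fun j => z j * s ^ j) (S K) + 2 * (a * s) ^ S (S K)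
  <= s * (1 + 2 * a ^ 2 * s)).
{ induction K as [|K IH].
  - simpl; rewrite z0; nra.
  - rewrite tech5; specialize (Hz (S (S K)) ltac:(lia)).
    apply (Rmult_le_compat_r (s ^ S (S K))) in Hz; [|now apply pow_le].
    rewrite <- Rpow_mult_distr in Hz.
    pose proof (pow_le (a * s) (S (S K)) Hq).
    change ((a * s) ^ S (S (S K))) with (a * s * (a * s) ^ S (S K)).
    nra. }
destruct N as [|N].
- simpl; rewrite z0; assert (0 <= a ^ 2 * s) by (apply Rmult_le_pos; [apply pow2_ge_0|easy]); nra.
- specialize (H N); pose proof (pow_le (a * s) (S (S N)) Hq); lra.
Qed.

(** The growth condition is multiplied over the indices m + 1, ..., m + k, where the squares n^2
    build up ((m+k)!/m!)^2. *)
Lemma weight_ratio_le (M : nat -> R) (b : R) :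
  (forall n, 0 < M n) -> 0 <= b ->
  (forall n, (1 <= n)%nat -> INR n ^ 2 * M (n - 1)%nat / M n <= b) ->
  forall m k, INR (fact (m + k)) ^ 2 * M m <= b ^ k * INR (fact m) ^ 2 * M (m + k)%nat.
Proof.
intros HM Hb H m; induction k as [|k IH].
- rewrite Nat.add_0_r; simpl; lra.
- specialize (H (m + S k)%nat ltac:(lia)).
  rewrite Rle_div_l in H by apply HM.
  replace (m + S k - 1)%nat with (m + k)%nat in H by lia.
  rewrite Nat.add_succ_r in *; rewrite fact_simpl, mult_INR, Rpow_mult_distr.
  apply (Rmult_le_compat_l (INR (S (m + k)) ^ 2)) in IH; [|apply pow2_ge_0].
  assert (0 <= b ^ k * INR (fact m) ^ 2) by
    (apply Rmult_le_pos; [now apply pow_le|apply pow2_ge_0]).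
  apply (Rmult_le_compat_l (b ^ k * INR (fact m) ^ 2)) in H; [|easy].
  simpl (b ^ S k); lra.
Qed.

Lemma bell_weight_sum_le (M z : nat -> R) (a b : R) :
  (forall n, 0 < M n) -> 0 < b ->
  (forall n, (1 <= n)%nat -> INR n ^ 2 * M (n - 1)%nat / M n <= b) ->
  (forall j, 0 <= z j) -> z 0%nat = 0 -> z 1%nat <= 1 ->
  0 <= a -> (forall j, (1 <= j)%nat -> z j <= a ^ j) ->
  exists K, 0 <= K /\ forall m N,
    sum_f_R0 (fun n => INR (fact n) / INR (fact m) * conv_pow z m n * (M m / M n)) N <= K.
Proof.
intros HM Hb Hsup Hz z0 z1 Ha Hza.
(* This size of [L] gives a s <= 1/2 below for every m, and L > 0. *)
destruct (INR_unbounded (2 * a * b + 1)) as [L HL].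
assert (HL1 : 0 < INR L) by nra.
set (c := (INR L + 1) ^ L).
assert (Hc : 0 <= c) by (apply pow_le; lra).
exists (c * exp (2 * a ^ 2 * b)); split; [apply Rmult_le_pos; [easy|apply Rlt_le, exp_pos]|].
intros m N; pose proof (pos_INR m) as Hm.
(* The radius depends on m: s (m + L) = b converts b^k into s^k (m + L)^k, while m s <= b keeps the
   final exponential bounded. *)
set (s := b / (INR m + INR L)).
assert (Hs : 0 < s) by (apply Rdiv_lt_0_compat; lra).
assert (Hsb : s * (INR m + INR L) = b) by (unfold s; field; lra).
assert (Has : a * s <= 1 / 2) by (unfold s; apply (Rmult_le_reg_r (INR m + INR L)); [lra|];
  rewrite Rmult_assoc; fold s; rewrite Hsb; lra).
assert (Hms : INR m * s <= b) by nra.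
assert (Hsm : 0 < s ^ m) by now apply pow_lt.
apply Rle_trans with (sum_f_R0 (fun n => conv_pow z m n * s ^ n * (c / s ^ m)) N).
- apply sum_Rle; intros n _.
  destruct (Nat.le_gt_cases m n) as [Hmn|Hmn]; [|rewrite conv_pow_eq0 by easy; apply Req_le; ring].
  destruct (Nat.le_exists_sub m n Hmn) as [k [-> _]]; rewrite (Nat.add_comm k m).
  pose proof (INR_fact_lt_0 m) as Fm; pose proof (INR_fact_lt_0 (m + k)) as Fn.
  pose proof (weight_ratio_le M b HM (Rlt_le _ _ Hb) Hsup m k) as HW.
  pose proof (fact_mul_pow_le L m k) as HF; fold c in HF.
  pose proof (HM (m + k)%nat) as HMn.
  rewrite Rmult_assoc, (Rmult_comm (_ / _)), !Rmult_assoc.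
  apply Rmult_le_compat_l; [now apply conv_pow_nonneg|].
  replace (s ^ (m + k) * (c / s ^ m)) with (c * s ^ k)
    by (rewrite pow_add; field; lra).
  (* The weights supply (m!/n!)^2 with n = m + k. One factor cancels n!/m!, and [fact_mul_pow_le]
     handles the other. *)
  apply Rle_trans with (b ^ k * INR (fact m) / INR (fact (m + k))).
  + apply (Rmult_le_reg_r (INR (fact m) * INR (fact (m + k)) * M (m + k)%nat)).
    { repeat apply Rmult_lt_0_compat; easy. }
    field_simplify; [|lra..].
    lra.
  + rewrite <- Hsb, Rpow_mult_distr; apply Rle_div_l; [easy|].
    pose proof (pow_le s k (Rlt_le _ _ Hs)) as Hsk.
    apply (Rmult_le_compat_l (s ^ k)) in HF; [|easy]; lra.
- rewrite <- scal_sum.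
  apply Rle_trans with (c / s ^ m * (s ^ m * exp (2 * a ^ 2 * b))).
  2: { apply Req_le; field; lra. }
  apply Rmult_le_compat_l.
  { apply Rmult_le_pos; [easy|apply Rlt_le, Rinv_0_lt_compat; easy]. }
  eapply Rle_trans; [apply sum_conv_pow_le; [easy|lra]|].
  eapply Rle_trans; [apply pow_incr; split;
    [apply cond_pos_sum; intros j; apply Rmult_le_pos; [easy|apply pow_le; lra]
    |apply (sum_geometric_tail_le z a s N); auto; lra]|].
  rewrite Rpow_mult_distr; apply Rmult_le_compat_l; [lra|].
  pose proof (pow2_ge_0 a) as Ha2.
  eapply Rle_trans; [apply pow_one_plus_le_exp; nra|].
  assert (HE : INR m * (2 * a ^ 2 * s) <= 2 * a ^ 2 * b) by nra.
  destruct HE as [HE| ->]; [apply Rlt_le, exp_increasing, HE|apply Rle_refl].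
Qed.

(** * Summation of the derivative bounds over all orders *)

Theorem theorem3p1 (M : nat -> R) (phi : R -> R)
  (hM : weight_sequence M)
  (hna : non_analytic M)
  (hsup : exists B : R, forall n : nat, (1 <= n)%nat ->
    INR n ^ 2 * M (n - 1)%nat / M n <= B)
  (hmaps : forall x : R, I01 x -> I01 (phi x))
  (hphi : analytic phi)
  (hderiv : supnorm (derive01_n (V := R_CompleteNormedModule) 1 phi) <= 1) :
  induces_endomorphism M phi.
Proof.
intros f [Hf Hser].
destruct hM as [HM _], hsup as [B0 HB0], hphi as [Hphi [A0 HA0]].
destruct (smooth01_comp f phi Hf Hphi hmaps) as [Hcomp Hder].
split; [exact Hcomp|].
set (z := sup_taylor_coef phi).
assert (Hz : forall j, 0 <= z j) by apply sup_taylor_coef_nonneg.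
(* The given bounds carry no sign information, so maxima enforce a >= 0 and b > 0. *)
destruct (bell_weight_sum_le M z (Rmax A0 0) (Rmax B0 1) HM) as [K [HK0 HK]].
- apply Rlt_le_trans with 1; [lra|apply Rmax_r].
- intros n Hn; eapply Rle_trans; [now apply HB0|apply Rmax_l].
- exact Hz.
- reflexivity.
- unfold z, sup_taylor_coef; simpl fact; simpl INR; rewrite Rdiv_1_r; exact hderiv.
- apply Rmax_r.
- intros j Hj; destruct j as [|j]; [lia|].
  apply nth_root_le; [lia|apply Rmax_r|].
  eapply Rle_trans; [apply (HA0 (S j)); lia|apply Rmax_l].
- set (F := fun m => supnorm (derive01_n m f)).
  assert (HF : forall m, 0 <= F m / M m).
  { intros m; apply Rmult_le_pos; [apply supnorm_nonneg|].
    apply Rlt_le, Rinv_0_lt_compat, HM. }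
  destruct (ex_series_nonneg_bound _ HF Hser) as [S HS].
  set (T := fun n m => INR (fact n) / INR (fact m) * conv_pow z m n * (M m / M n)).
  assert (Hbell : forall n m, 0 <= INR (fact n) / INR (fact m) * conv_pow z m n).
  { intros n m; apply Rmult_le_pos; [|now apply conv_pow_nonneg].
    apply Rlt_le, Rdiv_lt_0_compat; apply INR_fact_lt_0. }
  assert (HT : forall n m, 0 <= T n m).
  { intros n m; apply Rmult_le_pos; [apply Hbell|].
    apply Rlt_le, Rdiv_lt_0_compat; apply HM. }
  assert (Hsup : forall n, supnorm (derive01_n n (fun x => f (phi x))) / M n
    <= sum_f_R0 (fun m => T n m * (F m / M m)) n).
  { intros n; apply Rle_div_l; [apply HM|].
    apply supnorm_le; intros x Ix; rewrite (Hder n x Ix).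
    eapply Rle_trans; [exact (norm_sum_n_le (V := C_R_CompleteNormedModule)
      (fun m => scal (bell phi n m x) (derive01_n m f (phi x))) n)|].
    rewrite Rmult_comm, scal_sum; apply sum_Rle; intros m _.
    eapply Rle_trans; [apply (norm_scal (V := C_R_CompleteNormedModule))|].
    replace (T n m * (F m / M m) * M n)
      with (INR (fact n) / INR (fact m) * conv_pow z m n * F m).
    2: { unfold T; field; repeat split; try apply INR_fact_neq_0;
         apply Rgt_not_eq, HM. }
    apply Rmult_le_compat; [apply Rabs_pos|apply norm_ge_0| |].
    - unfold bell; change abs with Rabs; rewrite Rabs_mult, Rabs_pos_eq.
      2: { apply Rlt_le, Rdiv_lt_0_compat; apply INR_fact_lt_0. }
      apply Rmult_le_compat_l.
      { apply Rlt_le, Rdiv_lt_0_compat; apply INR_fact_lt_0. }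
      apply Rabs_conv_pow_le; intros j; now apply Rabs_taylor_coef_le.
    - apply smooth01_le_supnorm; auto. }
  apply (ex_series_nonneg_bounded _ (K * S)).
  { intros n; apply Rmult_le_pos; [apply supnorm_nonneg|].
    apply Rlt_le, Rinv_0_lt_compat, HM. }
  intros N.
  (* Nonnegative terms are added to fill the triangle m <= n up to a square, where the sums can be
     exchanged; summing over n first then bounds each column by [K]. *)
  apply Rle_trans with (sum_f_R0 (fun n => sum_f_R0 (fun m => T n m * (F m / M m)) N) N).
  { apply sum_Rle; intros n Hn; eapply Rle_trans; [apply Hsup|].
    apply sum_f_R0_le_le; [|exact Hn]; intros m; now apply Rmult_le_pos. }
  rewrite sum_f_R0_exchange.
  apply Rle_trans with (sum_f_R0 (fun m => F m / M m * K) N).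
  { apply sum_Rle; intros m _; rewrite <- scal_sum.
    apply Rmult_le_compat_l; [apply HF|apply HK]. }
  rewrite <- scal_sum; apply Rmult_le_compat_l; [exact HK0|apply HS].
Qed.
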